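(* Let $u\in\mathcal{H}$, $u\ne0$, and consider the least squares loss $\mathcal{L}(v):=\tfrac12\|u-v\|^2$ on a $d$-dimensional linear model class $\mathcal{M}\subseteq\mathcal{H}$, with $\mathcal{T}_t=\mathcal{M}$ and $R_t\equiv I$ the identity for all $t$. Let $P_t$ be the orthogonal projection onto $\mathcal{M}$, and suppose that the estimators $P_t^n$ satisfy the bias and variance bounds of the optimally sampled quasi-projection, i.e. for every $t$ and every $\mathcal{F}_t$-measurable $\mathcal{H}$-valued $g$ $$\mathbb{E}[(g,P_t^ng)\mid\mathcal{F}_t]\ge\|P_tg\|^2,\qquad\mathbb{E}[\|P_t^ng\|^2\mid\mathcal{F}_t]\le\tfrac{n-1+d}{n}\|P_tg\|^2+\tfrac dn\|(I-P_t)g\|^2 .$$ Suppose that $u_1=0$, that $n=c(d-1)\in\mathbb{N}$ for some constant $c\ge\frac1{d-1}$, and that the step size is chosen optimally, $s_t\equiv\frac{n}{n+d-1}$. Then for every $\varepsilon>0$, the perturbed relative error bound $$\mathbb{E}\left[\frac{\|u-u_{t+1}\|^2}{\|u\|^2}\right]\le\Big(1+\tfrac1{1+c}\tfrac d{d-1}\Big)\frac{\|u-P_tu\|^2}{\|u\|^2}+\varepsilon$$ is satisfied after $t=\frac{\ln(2\varepsilon^{-1})}{\ln(1+c)}$ iterations started from $u_1$ (i.e. for integers $t\ge1$ with $t\ge\frac{\ln(2\varepsilon^{-1})}{\ln(1+c)}$).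
   Context: $\mathcal{H}$ is a Hilbert space of functions with inner product $(\cdot,\cdot)$ and norm $\|\cdot\|$, and $(\Omega,\Sigma,\mathbb{P},(\mathcal{F}_t))$ is a filtered probability space. The iterates are defined by $u_{t+1}:=R_t(u_t-s_tP_t^ng_t)$ with $g_t:=\nabla\mathcal{L}(u_t)$ (the gradient in $\mathcal{H}$; here $g_t=u_t-u$). $P_t^n$ is a random operator with values in $\mathcal{T}_t$ (an estimator of the $\mathcal{H}$-orthogonal projection $P_t$ onto $\mathcal{T}_t$), built from $n$ sample points drawn at step $t$ conditionally on $\mathcal{F}_t$, so that $u_t$ is $\mathcal{F}_t$-measurable for every $t$. The ''optimal'' constant step size is the one maximising the descent factor $\sigma_t=s_t-\frac{s_t^2}{2}\frac{n+d-1}{n}$. *)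

(* Defs.v *)
From HB Require Import structures.
From mathcomp Require Import all_boot all_order all_algebra.
From mathcomp Require Import all_classical all_reals all_analysis.
From mathcomp Require Import measurable_realfun.

Set Implicit Arguments.
Unset Strict Implicit.
Unset Printing Implicit Defensive.

Import Order.TTheory GRing.Theory Num.Theory.
Import numFieldNormedType.Exports.

Local Open Scope classical_set_scope.
Local Open Scope ring_scope.

(** A real Hilbert space is a complete normed space [H] together with a
    symmetric positive definite bilinear form that induces the norm. *)
Definition hilbert_inner_product (R : realType) (H : completeNormedModType R)
    (ip : {dot H for idfun}) : Prop :=
  forall v : H, `|v| ^+ 2 = ip v v.

Definition subspace_of_dim (R : realType) (H : completeNormedModType R)
    (d : nat) (M : set H) : Prop :=
  exists b : 'I_d -> H,
    (forall a : 'I_d -> R, \sum_(i < d) a i *: b i = 0 -> forall i, a i = 0) /\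
    M = range (fun a : 'I_d -> R => \sum_(i < d) a i *: b i).

Definition orthogonal_projection (R : realType) (H : completeNormedModType R)
    (ip : {dot H for idfun}) (M : set H) (Pi : H -> H) : Prop :=
  forall v, M (Pi v) /\ forall w, M w -> ip (v - Pi v) w = 0.

(** Gradient: the Riesz representative of the Frechet derivative. *)
Definition is_gradient (R : realType) (H : completeNormedModType R)
    (ip : {dot H for idfun}) (f : H -> R) (v g : H) : Prop :=
  differentiable (f : H -> R^o) v /\
  forall h, 'd (f : H -> R^o) v h = ip g h.

Definition least_squares (R : realType) (H : completeNormedModType R)
    (u v : H) : R := 2^-1 * `|u - v| ^+ 2.

Definition filtration (disp : measure_display) (Omega : measurableType disp)
    (F : nat -> set_system Omega) : Prop :=
  [/\ forall t, sigma_algebra setT (F t),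
      forall t, F t `<=` measurable &
      forall s t, (s <= t)%N -> F s `<=` F t].

(** Measurability of an [H]-valued map with respect to the sigma-algebra
    generated by [G] on the source and the Borel sigma-algebra of [H]. *)
Definition vec_measurable (R : realType) (H : completeNormedModType R)
    (Omega : pointedType) (G : set_system Omega) (g : Omega -> H) : Prop :=
  measurable_fun setT
    (g : g_sigma_algebraType G -> g_sigma_algebraType (@open H)).

Definition ereal_measurable (R : realType) (Omega : pointedType)
    (G : set_system Omega) (Z : Omega -> \bar R) : Prop :=
  measurable_fun setT (Z : g_sigma_algebraType G -> \bar R).

(** [Z] is a version of E[X | G] for [X >= 0]; the value [+oo] is allowed, so
    that such a version exists for every nonnegative random variable. *)
Definition cond_exp_nonneg (R : realType) (disp : measure_display)
    (Omega : measurableType disp) (P : probability Omega R)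
    (G : set_system Omega) (X Z : Omega -> \bar R) : Prop :=
  [/\ ereal_measurable G Z, (forall w, 0 <= Z w)%E &
      forall A, G A ->
        (\int[P]_(w in A) Z w = \int[P]_(w in A) X w)%E].

(** [Z] is a version of E[X | G] := E[X^+ | G] - E[X^- | G], which makes sense
    as soon as the two terms are almost surely not both infinite. No
    integrability of [X] is needed: the bounds below are required for all
    measurable [g], also those with an infinite second moment. *)
Definition cond_exp (R : realType) (disp : measure_display)
    (Omega : measurableType disp) (P : probability Omega R)
    (G : set_system Omega) (X : Omega -> R) (Z : Omega -> \bar R) : Prop :=
  measurable_fun setT X /\
  exists Zp Zn : Omega -> \bar R,
    [/\ cond_exp_nonneg P G (fun w => (X^\+ w)%:E) Zp,
        cond_exp_nonneg P G (fun w => (X^\- w)%:E) Zn,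
        {ae P, forall w, (Zp w < +oo)%E \/ (Zn w < +oo)%E},
        ereal_measurable G Z &
        {ae P, forall w, Z w = (Zp w - Zn w)%E}].

(** A random operator on [H] with values in [M]: it sends [G]-measurable
    [H]-valued maps to random variables with values in [M]. *)
Definition random_operator (R : realType) (H : completeNormedModType R)
    (disp : measure_display) (Omega : measurableType disp)
    (G : set_system Omega) (M : set H) (Q : Omega -> H -> H) : Prop :=
  (forall w v, M (Q w v)) /\
  forall g : Omega -> H, vec_measurable G g ->
    vec_measurable measurable (fun w => Q w (g w)).

Definition bias_bound (R : realType) (H : completeNormedModType R)
    (ip : {dot H for idfun}) (disp : measure_display)
    (Omega : measurableType disp) (P : probability Omega R)
    (G : set_system Omega) (Pi : H -> H) (Q : Omega -> H -> H) : Prop :=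
  forall g : Omega -> H, vec_measurable G g ->
    exists Z : Omega -> \bar R,
      cond_exp P G (fun w => ip (g w) (Q w (g w))) Z /\
      {ae P, forall w, ((`|Pi (g w)| ^+ 2)%:E <= Z w)%E}.

Definition variance_bound (R : realType) (H : completeNormedModType R)
    (disp : measure_display) (Omega : measurableType disp)
    (P : probability Omega R) (G : set_system Omega) (n d : nat)
    (Pi : H -> H) (Q : Omega -> H -> H) : Prop :=
  forall g : Omega -> H, vec_measurable G g ->
    exists Z : Omega -> \bar R,
      cond_exp P G (fun w => `|Q w (g w)| ^+ 2) Z /\
      {ae P, forall w, (Z w <=
        ((n%:R - 1 + d%:R) / n%:R * `|Pi (g w)| ^+ 2
         + d%:R / n%:R * `|g w - Pi (g w)| ^+ 2)%:E)%E}.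

(** u_{t+1} = R_t (u_t - s_t P_t^n g_t) with g_t the gradient of [L] at u_t;
    time starts at 1 and the value of the sequences at 0 is irrelevant. *)
Definition descent_iterates (R : realType) (H : completeNormedModType R)
    (ip : {dot H for idfun}) (Omega : Type) (L : H -> R)
    (Rt : nat -> H -> H) (s : nat -> R) (Q : nat -> Omega -> H -> H)
    (x : nat -> Omega -> H) : Prop :=
  forall t, (1 <= t)%N -> forall w, exists g : H,
    is_gradient ip L (x t w) g /\
    x t.+1 w = Rt t (x t w - s t *: Q t w g).

(* Main.v *)
Require Import Defs.
From HB Require Import structures.
From mathcomp Require Import all_boot all_order all_algebra.
From mathcomp Require Import all_classical all_reals all_analysis.
From mathcomp Require Import measurable_realfun.
From mathcomp Require Import ring lra.

Set Implicit Arguments.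
Unset Strict Implicit.
Unset Printing Implicit Defensive.

Import Order.TTheory GRing.Theory Num.Theory.
Import numFieldNormedType.Exports.

Local Open Scope classical_set_scope.
Local Open Scope ring_scope.

(** Every iterate lies in the subspace [M], so by Pythagoras
    [`|u - x t| ^+ 2 = e t + r], where [e t := `|x t - Pi u| ^+ 2] and
    [r := `|u - Pi u| ^+ 2] does not depend on [t]. The gradient at [x t] is
    [g := x t - u], whose components along and orthogonal to [M] are
    [x t - Pi u] and [Pi u - u]. Expanding the square of [g - s *: Q g] gives
    [e t.+1 + 2 * s * ip g (Q g) = e t + s ^+ 2 * `|Q g| ^+ 2], and taking
    means with the bias and variance bounds yields, for
    [A := (n - 1 + d) / n],
    [E e t.+1 <= (1 - 2 * s + s ^+ 2 * A) * E e t + s ^+ 2 * (d / n) * r]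
    ([quasi_projection_step]). The optimal step is [s = A^-1 = c / (1 + c)].
    Then the contraction factor is [(1 + c)^-1], and
    [K := (1 + c)^-1 * (d / (d - 1)) * r] is the fixed point of the recursion,
    so that [E e t.+1 <= (1 + c)^-1 ^+ t * `|Pi u| ^+ 2 + K]. The condition on
    [t] makes the first term at most [eps / 2 * `|u| ^+ 2].

    The conditional bounds speak of the positive and negative parts of a
    possibly non-integrable variable. They are turned into inequalities
    between integrals of nonnegative functions ([integral_le_cond_exp],
    [cond_exp_le_integral]); finiteness comes from the variance bound, since
    [`|ip g (Q g)|] is dominated by [`|g| ^+ 2 + `|Q g| ^+ 2], and only then
    are integrals subtracted ([expected_descent]). *)

(** * Inner products, least squares and orthogonal projections *)

Section InnerProduct.
Variables (R : realType) (H : completeNormedModType R) (ip : {dot H for idfun}).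

Lemma ipC v w : ip v w = ip w v.
Proof. by rewrite hermC expr0 mul1r. Qed.

Lemma ipZl a v w : ip (a *: v) w = a * ip v w.
Proof. exact: linearZl_LR. Qed.

Lemma ipDl v1 v2 w : ip (v1 + v2) w = ip v1 w + ip v2 w.
Proof. exact: linearDl. Qed.

Lemma ipNl v w : ip (- v) w = - ip v w.
Proof. exact: linearNl. Qed.

Lemma ipBl v1 v2 w : ip (v1 - v2) w = ip v1 w - ip v2 w.
Proof. by rewrite ipDl ipNl. Qed.

Lemma ipDr v w1 w2 : ip v (w1 + w2) = ip v w1 + ip v w2.
Proof. by rewrite ipC ipDl !(ipC _ v). Qed.

Hypothesis Hip : hilbert_inner_product ip.

Lemma sqr_normD v w : `|v + w| ^+ 2 = `|v| ^+ 2 + 2 * ip v w + `|w| ^+ 2.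
Proof. by rewrite !Hip ipDl !ipDr (ipC w v); ring. Qed.

Lemma sqr_normBZ v w (a : R) :
  `|v - a *: w| ^+ 2 = `|v| ^+ 2 - 2 * a * ip v w + a ^+ 2 * `|w| ^+ 2.
Proof.
rewrite -scaleNr sqr_normD ipC ipZl ipC normrZ exprMn real_normK ?num_real //.
by ring.
Qed.

Lemma ip_definite v : ip v v = 0 -> v = 0.
Proof. by move/eqP; rewrite -Hip expf_eq0 /= normr_eq0 => /eqP. Qed.

(** Both signs follow from expanding the squares of [v + w] and [v - w]. *)
Lemma normr_ip_le v w : 2 * `|ip v w| <= `|v| ^+ 2 + `|w| ^+ 2.
Proof.
have := exprn_ge0 2 (normr_ge0 (v + w)).
have := exprn_ge0 2 (normr_ge0 (v - 1 *: w)).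
rewrite sqr_normBZ sqr_normD => h1 h2.
have [h|h] := ler0P (ip v w); lra.
Qed.

(** The loss is quadratic along each line, so its directional derivative at
    [v] is [ip (v - u) w]. Choosing as direction [w] the difference between
    [g] and [v - u] makes that difference orthogonal to itself. *)
Lemma gradient_least_squares u v g :
  is_gradient ip (least_squares u) v g -> g = v - u.
Proof.
move=> [df dfE]; apply/eqP; rewrite -subr_eq0; apply/eqP/ip_definite.
set w := g - (v - u); rewrite {1}/w ipBl -dfE -deriveE //; apply/eqP.
rewrite subr_eq0; apply/eqP; apply: cvg_lim; first exact: Rhausdorff.
have q h : least_squares u (h *: w + v) - least_squares u v =
    h * ip (v - u) w + 2^-1 * h ^+ 2 * `|w| ^+ 2.
  rewrite /least_squares -!(distrC _ u).
  have -> : h *: w + v - u = v - u - (- h) *: w.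
    by rewrite scaleNr opprK -addrA addrC.
  by rewrite sqr_normBZ; field.
apply: (@cvg_trans _ ((fun h : R => ip (v - u) w + h * (2^-1 * `|w| ^+ 2))
    @ 0^')).
  apply: near_eq_cvg; near=> h; rewrite /= q.
  have h0 : h != 0 by near: h; exact: nbhs_dnbhs_neq.
  by rewrite /GRing.scale /=; field.
have -> : nbhs (ip (v - u) w) =
    nbhs (ip (v - u) w + 0 * (2^-1 * `|w| ^+ 2)).
  by rewrite mul0r addr0.
apply: cvgD; first exact: cvg_cst.
by apply: cvgM; [exact: cvg_within | exact: cvg_cst].
Unshelve. all: by end_near. Qed.

Lemma subspace_lincomb d (M : set H) (a : R) v w :
  subspace_of_dim d M -> M v -> M w -> M (a *: v + w).
Proof.
move=> [b [_ ->]] [x _ <-] [y _ <-]; exists (fun i => a * x i + y i) => //.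
rewrite scaler_sumr -big_split /=; apply: eq_bigr => i _.
by rewrite scalerDl scalerA.
Qed.

Lemma subspace0 d (M : set H) : subspace_of_dim d M -> M 0.
Proof.
move=> [b [_ ->]]; exists (fun=> 0) => //.
by rewrite big1 // => i _; rewrite scale0r.
Qed.

Variables (d : nat) (M : set H) (Pi : H -> H).
Hypotheses (HM : subspace_of_dim d M) (HPi : orthogonal_projection ip M Pi).

Lemma orthogonal_projection_unique v p :
  M p -> (forall w, M w -> ip (v - p) w = 0) -> Pi v = p.
Proof.
move=> Mp op; have [MPi oPi] := HPi v.
have MB : M (p - Pi v).
  by rewrite -scaleN1r addrC; exact: subspace_lincomb HM _ _.
apply/esym/eqP; rewrite -subr_eq0; apply/eqP/ip_definite.
have {1}-> : p - Pi v = (v - Pi v) - (v - p).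
  by rewrite opprB [RHS]addrC addrA subrK.
by rewrite ipBl oPi // op // subrr.
Qed.

(** Since [y] is its own projection, projecting the gradient [y - u] only
    moves [u]. *)
Lemma projection_residual u y : M y -> Pi (y - u) = y - Pi u.
Proof.
move=> My; have [MPi oPi] := HPi u; apply: orthogonal_projection_unique.
  by rewrite -scaleN1r addrC; exact: subspace_lincomb HM _ _.
move=> w Mw; have -> : y - u - (y - Pi u) = - (u - Pi u).
  by rewrite !opprB [LHS]addrC addrA subrK.
by rewrite ipNl oPi // oppr0.
Qed.

(** Pythagoras: the error splits into the part that descent can reduce and the
    distance from [u] to [M]. *)
Lemma sqr_dist_subspace u y : M y ->
  `|u - y| ^+ 2 = `|y - Pi u| ^+ 2 + `|u - Pi u| ^+ 2.
Proof.
move=> My; have [MPi oPi] := HPi u.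
have -> : u - y = (u - Pi u) - 1 *: (y - Pi u).
  by rewrite scale1r opprB addrA subrK.
rewrite sqr_normBZ oPi; first by ring.
by rewrite -scaleN1r addrC; exact: subspace_lincomb HM _ _.
Qed.

End InnerProduct.

(** * Means of conditional expectations *)

Section ConditionalExpectation.
Variables (R : realType) (disp : measure_display) (Omega : measurableType disp).
Variables (P : probability Omega R) (G : set_system Omega).
Hypotheses (GS : sigma_algebra setT G) (Gm : G `<=` measurable).

(** The conditional expectations are measurable for [G] only; integrals need
    measurability for the ambient sigma-algebra. *)
Lemma sub_measurable_fun disp' (T : measurableType disp') (f : Omega -> T) :
  measurable_fun setT (f : g_sigma_algebraType G -> T) -> measurable_fun setT f.
Proof.
move=> mf _ A mA; apply: Gm; have := mf measurableT A mA.
by rewrite /measurable /= (sigma_algebra_id GS).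
Qed.

(** Sums of Borel maps into a non-separable space need not be Borel, so
    vector-valued measurability is only used through real functionals and
    through translations by a constant. *)
Lemma vec_measurable_continuous (H : completeNormedModType R)
    (g : Omega -> H) (phi : H -> R) :
  continuous phi -> vec_measurable G g -> measurable_fun setT (phi \o g).
Proof.
move=> /continuousP cphi mg; apply: (measurability _ (RGenOpens.measurableE R)).
move=> _ [_ [a [b ->] <-]]; rewrite comp_preimage.
have := mg measurableT (phi @^-1` `]a, b[%classic).
rewrite /measurable /= (sigma_algebra_id GS) => h.
apply: Gm; apply: h; apply: sub_sigma_algebra; apply: cphi.
exact: interval_open.
Qed.

Lemma vec_measurable_translate (H : completeNormedModType R)
    (g : Omega -> H) (u : H) :
  vec_measurable G g -> vec_measurable G (fun w => g w - u).
Proof.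
move=> mg; apply: (@measurability _ _ (g_sigma_algebraType G)
  (g_sigma_algebraType (@open H)) setT _ (@open H) erefl).
move=> _ [A oA <-].
have -> : (fun w => g w - u) @^-1` A = g @^-1` ((fun v => v - u) @^-1` A) by [].
apply: mg => //; apply: sub_sigma_algebra.
have /continuousP : continuous (fun v : H => v - u).
  by move=> v; apply: cvgB; [exact: cvg_id | exact: cvg_cst].
exact.
Qed.

Local Open Scope ereal_scope.

Lemma cond_exp_nonneg_integral (X Z : Omega -> \bar R) :
  cond_exp_nonneg P G X Z ->
  [/\ measurable_fun setT Z, forall w, 0 <= Z w &
      \int[P]_w Z w = \int[P]_w X w].
Proof.
move=> [mZ Z0 ZX]; split => //; first exact: sub_measurable_fun.
apply: ZX; case: GS => G0 GC _.
by have := GC _ G0; rewrite setD0.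
Qed.

(** Integrating [Y <= Zp - Zn] in the form [Y + Zn <= Zp] keeps all terms
    nonnegative, so that neither integrability of [X] nor cancellation of
    infinite values is at stake. *)
Lemma integral_le_cond_exp (X Y : Omega -> R) (Z : Omega -> \bar R) :
  cond_exp P G X Z -> measurable_fun setT Y -> (forall w, 0 <= Y w)%R ->
  {ae P, forall w, (Y w)%:E <= Z w} ->
  \int[P]_w (Y w)%:E + \int[P]_w (X^\- w)%:E <= \int[P]_w (X^\+ w)%:E.
Proof.
move=> [mX [Zp [Zn [hp hn _ _ ZE]]]] mY Y0 YZ.
have [mp p0 <-] := cond_exp_nonneg_integral hp.
have [mn n0 <-] := cond_exp_nonneg_integral hn.
have mYE : measurable_fun setT (EFin \o Y) by exact/measurable_EFinP.
rewrite -ge0_integralD //; last by move=> w _; rewrite lee_fin.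
apply: ae_ge0_le_integral => //.
- by move=> w _; apply: adde_ge0; rewrite ?lee_fin.
- exact: emeasurable_funD.
apply: filterS2 ZE YZ => w -> YZ _; move: YZ (n0 w) (p0 w).
(* An infinite [Zn w] would force [Z w = -oo], below the finite [Y w]. *)
case: (Zn w) => [b| |] //; case: (Zp w) => [a| |] //=.
  by rewrite -EFinB -EFinD !lee_fin => ? _ _; lra.
by move=> _ _ _; exact: leey.
Qed.

(** As [X] has no negative part, its [Zn] has zero integral and hence vanishes
    almost everywhere, so that [Z] agrees with [Zp]. *)
Lemma cond_exp_le_integral (X Y : Omega -> R) (Z : Omega -> \bar R) :
  cond_exp P G X Z -> (forall w, 0 <= X w)%R ->
  measurable_fun setT Y -> (forall w, 0 <= Y w)%R ->
  {ae P, forall w, Z w <= (Y w)%:E} ->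
  \int[P]_w (X w)%:E <= \int[P]_w (Y w)%:E.
Proof.
move=> [mX [Zp [Zn [hp hn _ _ ZE]]]] X0 mY Y0 YZ.
have [mp p0 ip] := cond_exp_nonneg_integral hp.
have [mn n0 i_n] := cond_exp_nonneg_integral hn.
have -> : \int[P]_w (X w)%:E = \int[P]_w Zp w.
  by rewrite ip; apply: eq_integral => w _; rewrite /funrpos max_l.
have Zn0 : {ae P, forall w, Zn w = 0}.
  have : \int[P]_w `|Zn w| = 0.
    under eq_integral do rewrite gee0_abs //.
    rewrite i_n; apply: integral0_eq => w _.
    by rewrite /funrneg max_r // oppr_le0.
  move/(ae_eq_integral_abs P measurableT mn); apply: filterS => w; exact.
have mYE : measurable_fun setT (EFin \o Y) by exact/measurable_EFinP.
apply: ae_ge0_le_integral => //; first by move=> w _; rewrite lee_fin.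
by apply: filterS3 ZE YZ Zn0 => w -> + Znw _; rewrite Znw sube0.
Qed.

End ConditionalExpectation.

(** * One step of descent in mean *)

Section ExpectedDescent.
Variables (R : realType) (disp : measure_display) (Omega : measurableType disp).
Variables (P : probability Omega R).

Local Open Scope ereal_scope.

Lemma integral_affine (a b : R) (f : Omega -> R) :
  (0 <= a)%R -> (0 <= b)%R ->
  measurable_fun setT f -> (forall w, 0 <= f w)%R ->
  \int[P]_w (a * f w + b)%:E = a%:E * \int[P]_w (f w)%:E + b%:E.
Proof.
move=> a0 b0 mf f0; under eq_integral do rewrite EFinD EFinM.
have mE : measurable_fun setT (EFin \o f) by exact/measurable_EFinP.
rewrite ge0_integralD //.
- rewrite ge0_integralZl //; last by move=> w _; rewrite lee_fin.
  by have := expectation_cst P b; rewrite unlock /= => ->.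
- by move=> w _; rewrite -EFinM lee_fin mulr_ge0.
- exact: measurable_funeM.
Qed.

Lemma ge0_integral_EFinD (a b : R) (f g : Omega -> R) :
  (0 <= a)%R -> (0 <= b)%R ->
  measurable_fun setT f -> (forall w, 0 <= f w)%R ->
  measurable_fun setT g -> (forall w, 0 <= g w)%R ->
  \int[P]_w (a * f w + b * g w)%:E =
    a%:E * \int[P]_w (f w)%:E + b%:E * \int[P]_w (g w)%:E.
Proof.
move=> a0 b0 mf f0 mg g0; under eq_integral do rewrite EFinD !EFinM.
have mfE : measurable_fun setT (EFin \o f) by exact/measurable_EFinP.
have mgE : measurable_fun setT (EFin \o g) by exact/measurable_EFinP.
rewrite ge0_integralD //; first last.
- exact: measurable_funeM.
- by move=> w _; rewrite -EFinM lee_fin mulr_ge0.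
- exact: measurable_funeM.
- by move=> w _; rewrite -EFinM lee_fin mulr_ge0.
by rewrite !ge0_integralZl // => w _; rewrite lee_fin.
Qed.

Lemma ge0_integral_fin (f : Omega -> R) (a : R) : (forall w, 0 <= f w)%R ->
  \int[P]_w (f w)%:E <= a%:E -> exists i : R, \int[P]_w (f w)%:E = i%:E.
Proof.
move=> f0; have : 0 <= \int[P]_w (f w)%:E.
  by apply: integral_ge0 => w _; rewrite lee_fin.
by case: (\int[P]_w _) => // i _ _; exists i.
Qed.

Variables (e e' X V : Omega -> R).
Hypotheses (me : measurable_fun setT e) (me' : measurable_fun setT e')
  (mX : measurable_fun setT X) (mV : measurable_fun setT V).
Hypotheses (e0 : forall w, (0 <= e w)%R) (e'0 : forall w, (0 <= e' w)%R)
  (V0 : forall w, (0 <= V w)%R).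

(** The one-step inequality in mean, free of Hilbert space notions: [e] and
    [e'] are the errors before and after the step, [X] the inner product of
    the gradient with its estimate, and [V] the squared norm of the estimate.
    The bound on [`|X|] makes the integrals of its two parts finite, which
    allows the bias inequality to be subtracted. *)
Lemma expected_descent (s A b r a : R) :
  (0 <= s)%R -> (0 <= r)%R -> (0 <= 1 - 2 * s + s ^+ 2 * A)%R ->
  (forall w, e' w + 2 * s * X w = e w + s ^+ 2 * V w)%R ->
  (forall w, `|X w| <= e w + r + V w)%R ->
  \int[P]_w (e w)%:E + \int[P]_w (X^\- w)%:E <= \int[P]_w (X^\+ w)%:E ->
  \int[P]_w (V w)%:E <= A%:E * \int[P]_w (e w)%:E + b%:E ->
  \int[P]_w (e w)%:E <= a%:E ->
  \int[P]_w (e' w)%:E <= ((1 - 2 * s + s ^+ 2 * A) * a + s ^+ 2 * b)%:E.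
Proof.
move=> s0 r0 q0 step Xle bias var ea.
have [i iE] := ge0_integral_fin e0 ea.
rewrite iE in var bias ea.
have [v vE] := ge0_integral_fin V0 var.
rewrite vE in var.
have mp : measurable_fun setT (X^\+)%R by exact: measurable_funrpos.
have mn : measurable_fun setT (X^\-)%R by exact: measurable_funrneg.
have p0 w : (0 <= X^\+ w)%R by exact: funrpos_ge0.
have n0 w : (0 <= X^\- w)%R by exact: funrneg_ge0.
have dom (Y : Omega -> R) : measurable_fun setT Y ->
    (forall w, 0 <= Y w)%R -> (forall w, Y w <= `|X w|)%R ->
    exists y : R, \int[P]_w (Y w)%:E = y%:E.
  (* The coefficients [1] give the bound [e + V + r] the shape that the
     integration lemmas expect. *)
  move=> mY Y0 YX; apply: (@ge0_integral_fin _ (1 * (1 * i + 1 * v) + r)) => //.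
  have -> : (1 * (1 * i + 1 * v) + r)%:E =
      \int[P]_w (1 * (1 * e w + 1 * V w) + r)%:E.
    rewrite integral_affine //.
    - by rewrite ge0_integral_EFinD // iE vE.
    - by apply: measurable_funD; exact: measurable_funM.
    - by move=> w; rewrite !mul1r addr_ge0.
  apply: ge0_le_integral => //.
  - by move=> w _; rewrite lee_fin.
  - exact/measurable_EFinP.
  - apply/measurable_EFinP; apply: measurable_funD => //.
    apply: measurable_funM => //.
    by apply: measurable_funD; exact: measurable_funM.
  - by move=> w _; rewrite lee_fin !mul1r; have := YX w; have := Xle w; lra.
have [p pE] : exists p : R, \int[P]_w (X^\+ w)%:E = p%:E.
  by apply: dom => // w; rewrite /funrpos ge_max normr_ge0 ler_norm.
have [m mE] : exists p : R, \int[P]_w (X^\- w)%:E = p%:E.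
  by apply: dom => // w; rewrite /funrneg ge_max normr_ge0 -normrN ler_norm.
rewrite pE mE -EFinD lee_fin in bias.
rewrite -EFinM -EFinD lee_fin in var.
rewrite lee_fin in ea.
(* The parts of [X] go to opposite sides, so that every integrand is
   nonnegative and the integral is additive. *)
have tw : (0 <= 2 * s)%R by lra.
have : \int[P]_w (1 * e' w + 2 * s * X^\+ w)%:E =
    \int[P]_w (1 * (1 * e w + 2 * s * X^\- w) + s ^+ 2 * V w)%:E.
  apply: eq_integral => w _; congr EFin.
  have XE : X w = (X^\+ w - X^\- w)%R by rewrite -{1}(funrposBneg X).
  by have := step w; rewrite XE; lra.
rewrite (ge0_integral_EFinD _ tw) //.
rewrite (ge0_integral_EFinD _ (sqr_ge0 s)) //; last 2 first.
- by apply: measurable_funD; exact: measurable_funM.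
- by move=> w; rewrite mul1r addr_ge0 ?mulr_ge0.
rewrite (ge0_integral_EFinD _ tw) // iE vE pE mE.
case: (\int[P]_w (e' w)%:E) => [j| |]; last 2 first.
- by rewrite mul1e -!EFinM -!EFinD.
- by rewrite leNye.
rewrite -!EFinM -!EFinD => -[jE]; rewrite lee_fin.
have h1 := ler_wpM2l tw bias.
have h2 := ler_wpM2l (sqr_ge0 s) var.
have h3 := ler_wpM2l q0 ea.
lra.
Qed.

End ExpectedDescent.

Section Descent.
Variables (R : realType) (H : completeNormedModType R) (ip : {dot H for idfun}).
Hypothesis Hip : hilbert_inner_product ip.
Variables (disp : measure_display) (Omega : measurableType disp).
Variables (P : probability Omega R).
Variables (d : nat) (M : set H) (Pi : H -> H).
Hypotheses (HM : subspace_of_dim d M) (HPi : orthogonal_projection ip M Pi).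
Variable u : H.

Lemma continuous_sqr_dist (v : H) : continuous (fun y : H => `|y - v| ^+ 2).
Proof.
move=> y.
apply: (@cvg_comp _ _ _ (fun y : H => `|y - v|) (fun a : R => a ^+ 2)).
  by apply: cvg_norm; apply: cvgB; [exact: cvg_id | exact: cvg_cst].
exact: exprn_continuous.
Qed.

(** One step of size [s] from a point of [M], for an arbitrary [s]: the bias
    term contracts the error inside [M], while the variance adds a multiple
    [A] of that error and a noise proportional to the squared distance from
    [u] to [M]. *)
Lemma quasi_projection_step (G : set_system Omega) (n : nat)
    (Q : Omega -> H -> H) (y : Omega -> H) (s a : R) :
  sigma_algebra setT G -> G `<=` measurable ->
  random_operator G M Q -> bias_bound ip P G Pi Q ->
  variance_bound P G n d Pi Q ->
  vec_measurable G y -> (forall w, M (y w)) ->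
  let A := (n%:R - 1 + d%:R) / n%:R : R in
  0 <= A -> 0 <= s -> 0 <= 1 - 2 * s + s ^+ 2 * A ->
  (\int[P]_w (`|y w - Pi u| ^+ 2)%:E <= a%:E)%E ->
  (\int[P]_w (`|y w - s *: Q w (y w - u) - Pi u| ^+ 2)%:E <=
    ((1 - 2 * s + s ^+ 2 * A) * a
      + s ^+ 2 * (d%:R / n%:R * `|u - Pi u| ^+ 2))%:E)%E.
Proof.
move=> GS Gm [QM _] bias var my My A A0 s0 q0 ya.
have mg := vec_measurable_translate u my.
have [Z [cX ZX]] := bias _ mg; have [W [cV WV]] := var _ mg.
have gE w : `|y w - u| ^+ 2 = `|y w - Pi u| ^+ 2 + `|u - Pi u| ^+ 2.
  by rewrite distrC; exact: (sqr_dist_subspace Hip HM HPi).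
have PgE w : Pi (y w - u) = y w - Pi u.
  exact: (projection_residual Hip HM HPi).
have rgE w : y w - u - Pi (y w - u) = - (u - Pi u).
  by rewrite PgE !opprB [LHS]addrC addrA subrK.
have me : measurable_fun setT (fun w => `|y w - Pi u| ^+ 2 : R).
  exact: (vec_measurable_continuous GS Gm (@continuous_sqr_dist _) my).
have step w : `|y w - s *: Q w (y w - u) - Pi u| ^+ 2
      + 2 * s * ip (y w - u) (Q w (y w - u)) =
    `|y w - Pi u| ^+ 2 + s ^+ 2 * `|Q w (y w - u)| ^+ 2.
  have My' : M (y w - s *: Q w (y w - u)).
    by rewrite -scaleNr addrC; exact: subspace_lincomb HM _ _.
  have := sqr_normBZ Hip (y w - u) (Q w (y w - u)) s.
  have -> : y w - u - s *: Q w (y w - u) = y w - s *: Q w (y w - u) - u.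
    by rewrite addrAC.
  rewrite distrC (sqr_dist_subspace Hip HM HPi _ My') gE; lra.
have mX := cX.1; have mV := cV.1.
apply: (@expected_descent _ _ _ P (fun w => `|y w - Pi u| ^+ 2)
  (fun w => `|y w - s *: Q w (y w - u) - Pi u| ^+ 2)
  (fun w => ip (y w - u) (Q w (y w - u))) (fun w => `|Q w (y w - u)| ^+ 2)
  _ _ _ _ _ _ _ s A _ (`|u - Pi u| ^+ 2)) => //.
- under eq_fun => w do rewrite (canRL (addrK _) (step w)).
  apply: measurable_funB; last exact: measurable_funM.
  by apply: measurable_funD => //; exact: measurable_funM.
- move=> w; rewrite -gE.
  have := normr_ip_le Hip (y w - u) (Q w (y w - u)).
  have := normr_ge0 (ip (y w - u) (Q w (y w - u))); lra.
- apply: (integral_le_cond_exp GS Gm cX) => //.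
  by apply: filterS ZX => w; rewrite PgE.
- rewrite -integral_affine //.
  apply: (cond_exp_le_integral GS Gm cV) => //.
  + by apply: measurable_funD => //; exact: measurable_funM.
  + move=> w; apply: addr_ge0; first exact: mulr_ge0.
    by rewrite mulr_ge0 ?divr_ge0.
  + by apply: filterS WV => w; rewrite rgE PgE normrN.
Qed.

End Descent.

(** * Geometric decay of the error along the iterates *)

Theorem corollary4p6
  (R : realType)
  (H : completeNormedModType R) (ip : {dot H for idfun})
  (Hip : hilbert_inner_product ip)
  (disp : measure_display) (Omega : measurableType disp)
  (P : probability Omega R)
  (F : nat -> set_system Omega) (HF : filtration F)
  (u : H) (Hu : u != 0)
  (d : nat) (Hd : (1 < d)%N)
  (M : set H) (HM : subspace_of_dim d M)
  (Pi : H -> H) (HPi : orthogonal_projection ip M Pi)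
  (n : nat) (c : R) (Hc : (d%:R - 1)^-1 <= c)
  (Hn : n%:R = c * (d%:R - 1))
  (Pn : nat -> Omega -> H -> H)
  (HPn : forall t, (1 <= t)%N -> random_operator (F t) M (Pn t))
  (Hbias : forall t, (1 <= t)%N -> bias_bound ip P (F t) Pi (Pn t))
  (Hvar : forall t, (1 <= t)%N -> variance_bound P (F t) n d Pi (Pn t))
  (s : nat -> R)
  (Hs : forall t, s t = n%:R / (n%:R + d%:R - 1))
  (x : nat -> Omega -> H)
  (Hadapted : forall t, (1 <= t)%N -> vec_measurable (F t) (x t))
  (Hx1 : forall w, x 1%N w = 0)
  (Hx : descent_iterates ip (least_squares u) (fun _ => id) s Pn x) :
  forall eps : R, 0 < eps ->
  forall t : nat, (1 <= t)%N -> ln (2 * eps^-1) / ln (1 + c) <= t%:R ->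
    ('E_P[fun w => (`|u - x t.+1 w| ^+ 2 / `|u| ^+ 2)%R]
      <= ((1 + (1 + c)^-1 * (d%:R / (d%:R - 1)))
            * (`|u - Pi u| ^+ 2 / `|u| ^+ 2) + eps)%:E)%E.
Proof.
move=> eps eps0 t t1 teps.
have [FS Fm _] := HF.
have D0 : 0 < d%:R - 1 :> R by rewrite subr_gt0 ltr1n.
have c0 : 0 < c by apply: lt_le_trans Hc; rewrite invr_gt0.
have c10 : 1 + c != 0 by rewrite lt0r_neq0 // addr_gt0.
have dn0 : d%:R - 1 != 0 :> R by rewrite lt0r_neq0.
have cn0 : c != 0 by rewrite lt0r_neq0.
have sE k : s k = c / (1 + c).
  rewrite Hs Hn; field; rewrite c10 /=.
  have -> : c * (d%:R - 1) + d%:R - 1 = (1 + c) * (d%:R - 1) by ring.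
  by rewrite mulf_neq0.
set r := `|u - Pi u| ^+ 2.
set A : R := (n%:R - 1 + d%:R) / n%:R.
have AE : A = (1 + c) / c.
  by rewrite /A Hn; field; rewrite cn0.
have xS k w : (1 <= k)%N -> x k.+1 w = x k w - s k *: Pn k w (x k w - u).
  by move=> k1; have [g [/(gradient_least_squares Hip) -> ->]] := Hx k k1 w.
have xM k w : M (x k.+1 w).
  elim: k => [|k IH]; first by rewrite Hx1; exact: subspace0 HM.
  rewrite xS // -scaleNr addrC; apply: subspace_lincomb HM _ IH.
  by have [QM _] := HPn k.+1 isT.
have u2 : `|u| ^+ 2 = `|Pi u| ^+ 2 + r.
  have := sqr_dist_subspace Hip HM HPi u (subspace0 HM).
  by rewrite subr0 sub0r normrN.
have err k : (\int[P]_w (`|x k.+1 w - Pi u| ^+ 2)%:E <=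
    ((1 + c)^-1 ^+ k * `|Pi u| ^+ 2
      + (1 + c)^-1 * (d%:R / (d%:R - 1)) * r)%:E)%E.
  elim: k => [|k IH].
    under eq_integral do rewrite Hx1 sub0r normrN.
    have := expectation_cst P (`|Pi u| ^+ 2); rewrite unlock /= => ->.
    rewrite lee_fin expr0 mul1r lerDl.
    by rewrite !mulr_ge0 ?divr_ge0 ?invr_ge0 ?exprn_ge0 // ltW // addr_gt0.
  under eq_integral do rewrite xS //.
  have := quasi_projection_step Hip HM HPi (FS k.+1) (Fm k.+1)
    (HPn k.+1 isT) (Hbias k.+1 isT) (Hvar k.+1 isT) (Hadapted k.+1 isT)
    (fun w => xM k w) _ _ _ IH (s := s k.+1).
  rewrite -/A AE -/r sE => /(_ _ _ _) h; apply: le_trans (h _ _ _) _.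
  - by rewrite divr_ge0 // ltW // addr_gt0.
  - by rewrite divr_ge0 // ltW // addr_gt0.
  - have -> : 1 - 2 * (c / (1 + c)) + (c / (1 + c)) ^+ 2 * ((1 + c) / c)
      = (1 + c)^-1 by field; rewrite c10.
    by rewrite invr_ge0 ltW // addr_gt0.
  (* The additive constant is the fixed point of the recursion, so that
     equality holds. *)
  - rewrite lee_fin Hn le_eqVlt; apply/orP; left; apply/eqP.
    rewrite [in RHS]exprS; move: (_ ^+ k) => qk.
    by field; rewrite c10 dn0 cn0.
(* Taking logarithms, this is exactly the hypothesis on [t]. *)
have pow : (1 + c)^-1 ^+ t <= eps / 2.
  have lc : 0 < ln (1 + c) by rewrite ln_gt0 // ltrDl.
  rewrite exprVn -[leRHS]invrK lef_pV2 ?posrE ?invr_gt0 ?divr_gt0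
    ?exprn_gt0 ?addr_gt0 //.
  rewrite invf_div -ler_ln ?posrE ?exprn_gt0 ?divr_gt0 ?addr_gt0 //.
  by rewrite lnXn ?addr_gt0 // -[_ *+ t]mulr_natl -ler_pdivrMr.
have up : 0 < `|u| ^+ 2 by rewrite exprn_even_gt0 //= normr_eq0.
have me : measurable_fun setT (fun w => `|x t.+1 w - Pi u| ^+ 2 : R).
  exact: (vec_measurable_continuous (FS _) (@Fm t.+1)
    (@continuous_sqr_dist _ _ _) (Hadapted t.+1 isT)).
rewrite unlock.
under eq_integral => w _.
  rewrite (sqr_dist_subspace Hip HM HPi u (xM t w)) mulrDl mulrC.
  over.
rewrite integral_affine //.
have := err t.
have : (0 <= \int[P]_w (`|x t.+1 w - Pi u| ^+ 2)%:E)%E.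
  by apply: integral_ge0 => w _; rewrite lee_fin exprn_ge0.
case: (\int[P]_w _)%E => // i _; rewrite lee_fin => ile.
rewrite -EFinM -EFinD lee_fin -/r.
have r0 : 0 <= r by rewrite exprn_ge0.
have P0 : 0 <= `|Pi u| ^+ 2 by rewrite exprn_ge0.
have decay : (1 + c)^-1 ^+ t * `|Pi u| ^+ 2 <= eps * `|u| ^+ 2.
  apply: (@le_trans _ _ (eps / 2 * `|Pi u| ^+ 2)); first exact: ler_wpM2r.
  by rewrite u2; nra.
have -> : (`|u| ^+ 2)^-1 * i + r / `|u| ^+ 2 = (i + r) / `|u| ^+ 2.
  by rewrite mulrDl mulrC.
rewrite ler_pdivrMr //.
have -> : ((1 + (1 + c)^-1 * (d%:R / (d%:R - 1))) * (r / `|u| ^+ 2) + eps)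
    * `|u| ^+ 2 = r + (1 + c)^-1 * (d%:R / (d%:R - 1)) * r + eps * `|u| ^+ 2.
  by field; rewrite normr_eq0 Hu c10 dn0.
lra.
Qed.
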